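(* Let $n\ge 2$ and let $k>0$ be a constant. Suppose that $\Omega$ is an $(a_1,\dots,a_{n-1})$-exterior convex domain in $\mathbb{R}^n$ with $a_1,\dots,a_{n-1}\ge 2$, and that $\mathbf 0\in\Omega$. If $u\in C(\overline\Omega)$ is a convex viscosity super-solution to the problem $$\det D^2u=|u|^{-n-k-2}(x\cdot Du-u)^{-k}\ \text{ in }\Omega,\qquad u=0\ \text{ on }\partial\Omega,$$ then $u\in C^{\theta}(\overline\Omega)$ and there exists a positive constant $C=C(n,k,\Omega)$ such that $|u|_{C^\theta(\overline\Omega)}\le C$, where $$\theta=\frac{\bar a+2+k}{2n+2k+2},\qquad \bar a=\sum_{i=1}^{n-1}\frac{2}{a_i}.$$
   Context: Exterior convex domain: Let $\Omega\subset\mathbb{R}^n$ be a bounded convex domain, and $a_i\ge 1$ for $i=1,\dots,n-1$. For $x_0\in\partial\Omega$, $\Omega$ satisfies the $(a_1,\dots,a_{n-1})$-exterior convex condition at $x_0$ if there exist positive constants $\eta_1,\dots,\eta_{n-1}$ such that, after a suitable translation and rotation, $x_0=\mathbf 0$ and $$\Omega\subseteq\{x\in\mathbb{R}^n: x_n>\eta_1|x_1|^{a_1}+\cdots+\eta_{n-1}|x_{n-1}|^{a_{n-1}}\}.$$ If this holds at every $x_0\in\partial\Omega$ with the same positive constants $\eta_1,\dots,\eta_{n-1}$ (the translation and rotation may depend on $x_0$), then $\Omega$ is called an $(a_1,\dots,a_{n-1})$-exterior convex domain. Convex viscosity super-solution: Let $\Omega$ be a convex domain with $\mathbf 0\in\Omega$,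 and let $u\in C(\overline\Omega)$ be convex in $\Omega$ with $u<0$ in $\Omega$. $u$ is a convex viscosity super-solution of the equation $\det D^2u=|u|^{-n-k-2}(x\cdot Du-u)^{-k}$ in $\Omega$ if, whenever $\phi\in C^2(\Omega)$ is convex and $z\in\Omega$ are such that $(u-\phi)(x)\ge(u-\phi)(z)$ for all $x$ in a neighborhood of $z$, one has $$\det D^2\phi(z)\le|u(z)|^{-n-k-2}\,(z\cdot D\phi(z)-u(z))^{-k}.$$ It is a convex viscosity super-solution to the boundary value problem if in addition $u=0$ on $\partial\Omega$. $C^\theta(\overline\Omega)$ is the space of Hölder continuous functions with exponent $\theta$ on $\overline\Omega$, with its Hölder norm $|\cdot|_{C^\theta(\overline\Omega)}$. *)

(* Defs.v *)
(* Points of R^n are row vectors 'rV[R]_n over a realType R;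
   their library norm is the sup norm (it is used only through the topology and
   boundedness), so Euclidean distances are written with [enorm] below. *)
From HB Require Import structures.
From mathcomp Require Import all_boot all_order all_algebra.
From mathcomp Require Import all_classical all_reals all_analysis.

Set Implicit Arguments.
Unset Strict Implicit.
Unset Printing Implicit Defensive.

Import Order.TTheory GRing.Theory Num.Theory.
Import numFieldNormedType.Exports.

Local Open Scope classical_set_scope.
Local Open Scope ring_scope.

Section Euclidean.
Context {R : realType} {n : nat}.
Implicit Types (x y : 'rV[R]_n) (Q : 'M[R]_n) (D : set 'rV[R]_n).

Definition dot x y : R := \sum_(i < n) x 0 i * y 0 i.

Definition enorm x : R := Num.sqrt (dot x x).

Definition is_rotation Q : Prop := Q *m Q^T = 1%:M /\ \det Q = 1.

Definition boundary D : set 'rV[R]_n := closure D `\` interior D.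

(* Connectedness follows from convexity. *)
Definition convex_domain D : Prop := [/\ D !=set0, open D & convex_set D].

End Euclidean.

Section ExteriorConvex.
Context {R : realType} {m : nat}.
Implicit Types (a eta : 'I_m -> R) (D : set 'rV[R]_m.+1).

(* The ambient dimension is m.+1; the first m coordinates of y are
   y 0 (widen_ord (leqnSn m) i) for i : 'I_m, and the last is y 0 ord_max. *)
Definition exterior_region a eta : set 'rV[R]_m.+1 :=
  [set y | \sum_(i < m) eta i * `|y 0 (widen_ord (leqnSn m) i)| `^ a i
             < y 0 ord_max].

(* In the coordinates y = (x - x0) Q the point x0 becomes the origin. *)
Definition exterior_convex_with a eta D (x0 : 'rV[R]_m.+1) : Prop :=
  exists Q : 'M[R]_m.+1, is_rotation Q /\
    (forall x, D x -> exterior_region a eta ((x - x0) *m Q)).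

Definition exterior_convex_domain a D : Prop :=
  [/\ convex_domain D, bounded_set D, (forall i, 1 <= a i) &
      exists eta : 'I_m -> R, (forall i, 0 < eta i) /\
        (forall x0, boundary D x0 -> exterior_convex_with a eta D x0)].

End ExteriorConvex.

Section SuperSolution.
Context {R : realType} {n : nat}.
Implicit Types (D : set 'rV[R]_n) (u phi : 'rV[R]_n -> R) (x : 'rV[R]_n).

Definition partial (i : 'I_n) phi : 'rV[R]_n -> R := 'D_(delta_mx 0 i) phi.

Definition gradient phi x : 'rV[R]_n := \row_(i < n) partial i phi x.

Definition hessian phi x : 'M[R]_n :=
  \matrix_(i < n, j < n) partial j (partial i phi) x.

(* For D open, [C1_on D phi] and [C2_on D phi] constrain only the
   values of phi on D. *)
Definition C1_on D phi : Prop :=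
  forall x, D x -> {for x, continuous phi} /\
    (forall i, derivable phi x (delta_mx 0 i) /\
               {for x, continuous (partial i phi)}).

Definition C2_on D phi : Prop :=
  C1_on D phi /\ (forall i, C1_on D (partial i phi)).

(* det D^2 u = |u|^{-n-k-2} (x . Du - u)^{-k} in D.  For D a convex domain
   containing 0, both bases are positive at an admissible z: u z < 0 and, the
   gradient of phi at z being a subgradient of the convex function u,
   dot z (gradient phi z) - u z >= - u 0 > 0. *)
Definition convex_viscosity_supersolution (k : R) D u : Prop :=
  [/\ {within closure D, continuous u},
      convex_function D u,
      (forall x, D x -> u x < 0) &
      forall phi z, C2_on D phi -> convex_function D phi -> D z ->
        (\forall x \near z, u z - phi z <= u x - phi x) ->
        \det (hessian phi z) <=
          `|u z| `^ (- n%:R - k - 2) *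
          (dot z (gradient phi z) - u z) `^ (- k)].

Definition convex_viscosity_supersolution_bvp (k : R) D u : Prop :=
  convex_viscosity_supersolution k D u /\
  (forall x, boundary D x -> u x = 0).

End SuperSolution.

Section Holder.
Context {R : realType} {n : nat}.
Implicit Types (A : set 'rV[R]_n) (u : 'rV[R]_n -> R) (theta : R).
Local Open Scope ereal_scope.

Definition sup_norm A u : \bar R := ereal_sup [set `|u x|%:E | x in A].

Definition holder_seminorm theta A u : \bar R :=
  ereal_sup [set r | exists x y : 'rV[R]_n, [/\ A x, A y, x != y &
    r = (`|u x - u y| / enorm (x - y) `^ theta)%:E]].

Definition holder_norm theta A u : \bar R :=
  sup_norm A u + holder_seminorm theta A u.

Definition holder_space theta A : set ('rV[R]_n -> R) :=
  [set u | {within A, continuous u} /\ holder_norm theta A u < +oo].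

End Holder.

(* Main.v *)
(* In coordinates y = (x - x0) Q adapted to a boundary point x0, write T for
   the last coordinate and Y_i for the others; on Omega, T > 0 and
   Y_i^2 <= C T^(2/a_i).  The barrier
     phi = sum_i Y_i^2 T^(theta - 2/a_i) - N T^theta
   is nonpositive and homogeneous of degree theta under T -> s T,
   Y_i -> s^(1/a_i) Y_i, and theta is exactly the degree for which
   det D^2 phi and |phi|^(-n-k-2) (x . D phi - phi)^(-k) scale alike.  For N
   large, uniformly in x0, phi is convex with det D^2 phi strictly larger, and
   the right-hand side only decreases when phi is replaced by a smaller u with
   the same gradient; so u cannot be touched from below by a translate of phi
   at a point where u < phi, whence u >= phi >= - N |x - x0|^theta.  This decay
   at every boundary point gives the Hoelder bound inside: if the ray from x
   through y leaves Omega at x + s (y - x), then u y - u x <= - u x / s by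
   convexity, and - u x is controlled by the decay at the exit point. *)
Require Import Defs.
From HB Require Import structures.
From mathcomp Require Import all_boot all_order all_algebra.
From mathcomp Require Import all_classical all_reals all_analysis.
From mathcomp Require Import ring lra.

Set Implicit Arguments.
Unset Strict Implicit.
Unset Printing Implicit Defensive.

Import Order.TTheory GRing.Theory Num.Theory.
Import numFieldNormedType.Exports.

Local Open Scope classical_set_scope.
Local Open Scope ring_scope.

(** * Directional derivatives and convexity *)

Section DirectionalCalculus.
Context {R : realType} {V : normedModType R}.
Implicit Types (f g : V -> R) (x v : V).

(** Both sides are limits of the same difference quotient. This carries one-variable facts, the
    chain rule for powers and the second-derivative test for convexity, over to directional
    derivatives. *)
Lemma is_derive_line f x v (h df : R) :
  is_derive (h *: v + x) v f df <->
  is_derive h 1 (fun t : R => f (t *: v + x)) df.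
Proof.
pose g (t : R) := f (t *: v + x).
have shiftE (t : R) : t *: v + (h *: v + x) = (t%:A + h) *: v + x.
  by rewrite scalerDl addrA [_%:A]mulr1.
have DE : 'D_v f (h *: v + x) = 'D_1 g h.
  rewrite /derive; set g1 := fun h => h^-1 *: _; set g2 := fun h => h^-1 *: _.
  suff -> : g1 = g2 by [].
  by rewrite funeqE /g1 /g2 => t /=; rewrite shiftE.
have dE : derivable f (h *: v + x) v <-> derivable g h 1.
  rewrite /derivable; set g1 := fun h => h^-1 *: _; set g2 := fun h => h^-1 *: _.
  suff -> : g1 = g2 by [].
  by rewrite funeqE /g1 /g2 => t /=; rewrite shiftE.
split=> -[dfx <-].
  by apply: DeriveDef; [exact: dE.1 dfx|exact: esym DE].
by apply: DeriveDef; [exact: dE.2 dfx|exact: DE].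
Qed.

Lemma is_derive_powR f x v (p df : R) : 0 < f x -> is_derive x v f df ->
  is_derive x v (fun z => f z `^ p) (p * f x `^ (p - 1) * df).
Proof.
move=> fx0 fd.
have lineE (g : V -> R) (dg : R) :
    is_derive x v g dg <-> is_derive (0 : R) 1 (fun t : R => g (t *: v + x)) dg.
  by rewrite -is_derive_line scale0r add0r.
apply/lineE; move/lineE: fd => fd.
have fx0' : 0 < f (0 *: v + x) by rewrite scale0r add0r.
have := is_derive1_comp (is_derive1_powR p fx0') fd.
by rewrite scale0r add0r.
Qed.

Lemma continuous_powR_pos f x (p : R) : 0 < f x -> {for x, continuous f} ->
  {for x, continuous (fun z => f z `^ p)}.
Proof.
move=> fx0 fc.
have pc : {for f x, continuous (fun y : R => y `^ p)}.
  apply/differentiable_continuous/derivable1_diffP.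
  by apply: derivable_powR; rewrite in_itv/= andbT.
exact: (continuous_comp fc pc).
Qed.

Local Open Scope convex_scope.

(** Restricting f to the segment from x to y reduces the claim to the one-variable test. The
    derivatives are passed as explicit functions so that closed formulas can be supplied for
    them. *)
Lemma convex_function_of_derive2 (D : set V) f (f1 f2 : V -> V -> R) :
  convex_set D ->
  (forall x v, D x -> is_derive x v f (f1 v x)) ->
  (forall x v, D x -> is_derive x v (f1 v) (f2 v x)) ->
  (forall x v, D x -> 0 <= f2 v x) ->
  convex_function D f.
Proof.
move=> Dc d1 d2 pos t x y xD yD.
pose v := y - x; pose g (h : R) := f (h *: v + x).
have seg (h : R) : 0 <= h <= 1 -> D (h *: v + x).
  move=> h01.
  have := Dc y x (Itv01 (andP h01).1 (andP h01).2) yD xD; rewrite inE.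
  congr D; rewrite /v scalerBr -addrA; congr (_ + _).
  by rewrite /= scalerBl scale1r addrC.
have g1 (h : R) : 0 <= h <= 1 -> is_derive h 1 g (f1 v (h *: v + x)).
  by move=> /seg h01; apply/is_derive_line; exact: d1.
have g2 (h : R) : 0 <= h <= 1 ->
    is_derive h 1 (fun h => f1 v (h *: v + x)) (f2 v (h *: v + x)).
  by move=> /seg h01; apply/is_derive_line; exact: d2.
(* The one-variable test differentiates ['D_1 g], which is known to agree with [f1 v] along the line
   only on the unit interval; at an interior h this is agreement near h. *)
have near1 (h : R) : 0 < h < 1 -> \near h, f1 v (h *: v + x) = 'D_1 g h.
  move=> h01; have : h \in `]0, 1[%R by rewrite in_itv/=.
  move=> /near_in_itvoo; apply: filterS => z; rewrite in_itv/= => /andP[z0 z1].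
  by have /g1[_ <-] : 0 <= z <= 1 by rewrite (ltW z0) (ltW z1).
have g2' (h : R) : 0 < h < 1 -> is_derive h 1 ('D_1 g) (f2 v (h *: v + x)).
  move=> h01; apply: near_eq_is_derive (near1 _ h01) _.
  by apply: g2; case/andP: h01 => h0 h1; rewrite (ltW h0) (ltW h1).
have cg (h : R) : 0 <= h <= 1 -> {for h, continuous g}.
  by move=> /g1 [dg _]; apply/differentiable_continuous/derivable1_diffP.
have D1g (h : R) : h \in `]0, 1[%R -> 0 < h < 1 by rewrite in_itv.
have <- : g 0 = f x by rewrite /g scale0r add0r.
have <- : g 1 = f y by rewrite /g scale1r subrK.
have <- : g ((0 : R^o) <| t |> (1 : R^o)) = f (x <| t |> y).
  rewrite /g convRE mulr0 mulr1 add0r /v; congr f.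
  rewrite scalerBr -addrA addrC; congr (_ + _).
  by rewrite scalerBl scale1r opprB subrK.
apply: second_derivative_convex => //.
- by move=> h h01; have [_ ->] := g2' h h01; case/andP: h01 => h0 h1;
    apply/pos/seg; rewrite (ltW h0) (ltW h1).
- by apply: cvg_at_left_filter; apply: cg; rewrite ler01 lexx.
- by apply: cvg_at_right_filter; apply: cg; rewrite ler01 lexx.
- by move=> h /D1g /andP[h0 h1]; have /g1[] : 0 <= h <= 1
    by rewrite (ltW h0) (ltW h1).
- by move=> h /D1g /g2'[].
Qed.

End DirectionalCalculus.

(** * The barrier *)

Lemma continuous_sum {R : realType} {V : normedModType R} n
    (f : 'I_n -> V -> R) x : (forall i, {for x, continuous (f i)}) ->
  {for x, continuous (fun z => \sum_i f i z)}.
Proof.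
by move=> fc; apply: cvg_big => // [|i _]; [exact: add_continuous|exact: fc].
Qed.

Lemma open_near {V : topologicalType} (D P : set V) x :
  open D -> D x -> (forall z, D z -> P z) -> \forall z \near x, P z.
Proof. by move=> Do Dx DP; exact: (filterS DP (open_nbhs_nbhs (conj Do Dx))). Qed.

Section Barrier.
Context {R : realType} {m : nat}.
Variables (Q : 'M[R]_m.+1) (x0 : 'rV[R]_m.+1) (N theta : R) (beta : 'I_m -> R).
Implicit Types (x v w : 'rV[R]_m.+1) (i : 'I_m) (l : 'I_m.+1).

Local Notation tangential i := (widen_ord (leqnSn m) i).

Definition rcoord l x : R := ((x - x0) *m Q) 0 l.

Definition rdir l v : R := (v *m Q) 0 l.

Local Notation T := (rcoord ord_max).
Local Notation Y i := (rcoord (tangential i)).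
Local Notation tau := (rdir ord_max).
Local Notation ups i := (rdir (tangential i)).

(** Here [beta i] stands for theta - 2/a_i. The exponents stay free parameters until the constants
    are chosen, since the calculus below only uses T > 0. *)
Definition barrier x : R :=
  \sum_(i < m) Y i x ^+ 2 * T x `^ beta i - N * T x `^ theta.

Definition barrier_d1 v x : R :=
  \sum_(i < m) (2 * Y i x * ups i v * T x `^ beta i
    + beta i * Y i x ^+ 2 * tau v * T x `^ (beta i - 1))
  - N * theta * tau v * T x `^ (theta - 1).

(** The mixed derivative along v, then w. Exponents such as [beta i - 1 - 1] are left in the shape
    produced by two applications of the power rule. *)
Definition barrier_d2 v w x : R :=
  \sum_(i < m) (2 * ups i v * ups i w * T x `^ beta i
    + 2 * beta i * Y i x * ups i v * tau w * T x `^ (beta i - 1)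
    + 2 * beta i * Y i x * ups i w * tau v * T x `^ (beta i - 1)
    + beta i * (beta i - 1) * Y i x ^+ 2 * tau v * tau w * T x `^ (beta i - 1 - 1))
  - N * theta * (theta - 1) * tau v * tau w * T x `^ (theta - 1 - 1).

Lemma is_derive_rcoord l x v : is_derive x v (rcoord l) (rdir l v).
Proof.
have /is_derive_line : is_derive (0 : R) 1
    (fun t : R => rcoord l (t *: v + x)) (rdir l v).
  have -> : (fun t : R => rcoord l (t *: v + x)) =
      (fun t : R => t) * cst (rdir l v) + cst (rcoord l x).
    apply/funext => t; rewrite /rcoord /rdir -addrA mulmxDl.
    by rewrite -scalemxAl mxE [in LHS]mxE.
  by apply: is_derive_eq; rewrite scaler0 add0r addr0 [LHS]mulr1.
by rewrite scale0r add0r.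
Qed.

Lemma continuous_rcoord l : continuous (rcoord l).
Proof.
have -> : rcoord l = (fun x => \sum_j (x 0 j - x0 0 j) * Q j l).
  apply/funext => x; rewrite /rcoord mxE.
  by apply: eq_bigr => j _; rewrite !mxE.
move=> x; apply: continuous_sum => j.
have cj : (fun z : 'rV[R]_m.+1 => z 0 j - x0 0 j) z @[z --> x] --> x 0 j - x0 0 j.
  exact: (cvgB (@coord_continuous _ _ _ 0 j x) (cvg_cst _)).
exact: (cvgMr_tmp cj).
Qed.

Lemma is_derive_barrier x v : 0 < T x -> is_derive x v barrier (barrier_d1 v x).
Proof.
move=> T0; have dT := is_derive_rcoord ord_max x v.
have dY i := is_derive_rcoord (tangential i) x v.
have dP p := is_derive_powR p T0 dT.
have dS i : is_derive x v (fun z => Y i z ^+ 2 * T z `^ beta i)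
    (2 * Y i x * ups i v * T x `^ beta i
    + beta i * Y i x ^+ 2 * tau v * T x `^ (beta i - 1)).
  have := is_deriveM (is_deriveX 2 (dY i)) (dP (beta i)).
  by move/is_derive_eq; apply; rewrite exprfctE /GRing.scale /=; ring.
have := is_deriveB (is_derive_sum dS) (is_deriveZ N (dP theta)).
rewrite fct_sumE; move/is_derive_eq; apply.
by rewrite /barrier_d1 /GRing.scale /=; ring.
Qed.

Lemma is_derive_barrier_d1 x v w : 0 < T x ->
  is_derive x w (barrier_d1 v) (barrier_d2 v w x).
Proof.
move=> T0; have dT := is_derive_rcoord ord_max x w.
have dY i := is_derive_rcoord (tangential i) x w.
have dP p := is_derive_powR p T0 dT.
have dS i : is_derive x w (fun z => 2 * Y i z * ups i v * T z `^ beta i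
    + beta i * Y i z ^+ 2 * tau v * T z `^ (beta i - 1))
    (2 * ups i v * ups i w * T x `^ beta i
    + 2 * beta i * Y i x * ups i v * tau w * T x `^ (beta i - 1)
    + 2 * beta i * Y i x * ups i w * tau v * T x `^ (beta i - 1)
    + beta i * (beta i - 1) * Y i x ^+ 2 * tau v * tau w * T x `^ (beta i - 1 - 1)).
  have := is_deriveD
    (is_deriveZ (2 * ups i v) (is_deriveM (dY i) (dP (beta i))))
    (is_deriveZ (beta i * tau v)
      (is_deriveM (is_deriveX 2 (dY i)) (dP (beta i - 1)))).
  move/is_derive_eq => H.
  have -> : (fun z => 2 * Y i z * ups i v * T z `^ beta i
    + beta i * Y i z ^+ 2 * tau v * T z `^ (beta i - 1)) =
    (2 * ups i v) *: (Y i * (fun z => T z `^ beta i)) +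
    (beta i * tau v) *: (Y i ^+ 2 * (fun z => T z `^ (beta i - 1))).
    by apply/funext => z; rewrite !fctE /GRing.scale /=; ring.
  by apply: H; rewrite !fctE /GRing.scale /=; ring.
have := is_deriveB (is_derive_sum dS)
  (is_deriveZ (N * theta * tau v) (dP (theta - 1))).
rewrite fct_sumE; move/is_derive_eq; apply.
by rewrite /barrier_d2 /GRing.scale /=; ring.
Qed.

Lemma continuous_T_powR p x : 0 < T x -> {for x, continuous (fun z => T z `^ p)}.
Proof. by move=> T0; apply: continuous_powR_pos => //; exact: continuous_rcoord. Qed.

Let cD x (f g : 'rV[R]_m.+1 -> R) : {for x, continuous f} ->
  {for x, continuous g} -> {for x, continuous (fun z => f z + g z)}.
Proof. by move=> fc gc; exact: (cvgD fc gc). Qed.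

Let cM x (f g : 'rV[R]_m.+1 -> R) : {for x, continuous f} ->
  {for x, continuous g} -> {for x, continuous (fun z => f z * g z)}.
Proof. by move=> fc gc; exact: (cvgM fc gc). Qed.

Let cMl x (c : R) (f : 'rV[R]_m.+1 -> R) : {for x, continuous f} ->
  {for x, continuous (fun z => c * f z)}.
Proof. by move=> fc; exact: (cvgMl_tmp fc). Qed.

Let cMr x (c : R) (f : 'rV[R]_m.+1 -> R) : {for x, continuous f} ->
  {for x, continuous (fun z => f z * c)}.
Proof. by move=> fc; exact: (cvgMr_tmp fc). Qed.

Let cB x (c : R) (f g : 'rV[R]_m.+1 -> R) : {for x, continuous f} ->
  {for x, continuous g} -> {for x, continuous (fun z => f z - c * g z)}.
Proof. by move=> fc gc; exact: (cvgB fc (cMl gc)). Qed.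

Lemma continuous_barrier x : 0 < T x -> {for x, continuous barrier}.
Proof.
move=> T0; have cP p := @continuous_T_powR p x T0.
have cY i := @continuous_rcoord (tangential i) x.
apply: cB => //; apply: continuous_sum => i; apply: cM => //.
exact: (cM (cY i) (cY i)).
Qed.

Lemma continuous_barrier_d1 v x : 0 < T x -> {for x, continuous (barrier_d1 v)}.
Proof.
move=> T0; have cP p := @continuous_T_powR p x T0.
have cY i := @continuous_rcoord (tangential i) x.
apply: cB => //; apply: continuous_sum => i; apply: cD.
  by apply: cM => //; apply: cMr; apply: cMl; exact: cY.
by apply: cM => //; apply: cMr; apply: cMl; exact: (cM (cY i) (cY i)).
Qed.

Lemma continuous_barrier_d2 v w x : 0 < T x ->
  {for x, continuous (barrier_d2 v w)}.
Proof.
move=> T0; have cP p := @continuous_T_powR p x T0.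
have cY i := @continuous_rcoord (tangential i) x.
apply: cB => //; apply: continuous_sum => i; do 3?apply: cD.
- by apply: cMl; exact: cP.
- by apply: cM => //; do 2 apply: cMr; apply: cMl; exact: cY.
- by apply: cM => //; do 2 apply: cMr; apply: cMl; exact: cY.
- by apply: cM => //; do 2 apply: cMr; apply: cMl; exact: (cM (cY i) (cY i)).
Qed.

(** The partial derivatives are identified with the explicit formulas only where T > 0. As D is
    open, this holds near each of its points, which is enough to transfer continuity and
    derivability. *)
Lemma C2_on_barrier (D : set 'rV[R]_m.+1) : open D -> (forall x, D x -> 0 < T x) ->
  C2_on D barrier.
Proof.
move=> Do DT.
have near_partial x (i : 'I_m.+1) : D x ->
    \near x, barrier_d1 (delta_mx 0 i) x = partial i barrier x.
  move=> Dx; apply: open_near Do Dx _ => z /DT T0.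
  by have [_ <-] := is_derive_barrier (delta_mx 0 i) T0.
have near_continuous x (f g : 'rV[R]_m.+1 -> R) : (\near x, f x = g x) ->
    {for x, continuous f} -> {for x, continuous g}.
  move=> fg fc; rewrite /prop_for /continuous_at -(nbhs_singleton fg).
  exact: cvg_trans (near_eq_cvg fg) fc.
split=> [x Dx|i x Dx]; split=> [|j].
- by apply: continuous_barrier; exact: DT.
- split; first by have [] := is_derive_barrier (delta_mx 0 j) (DT _ Dx).
  apply: near_continuous (near_partial x j Dx) _.
  by apply: continuous_barrier_d1; exact: DT.
- apply: near_continuous (near_partial x i Dx) _.
  by apply: continuous_barrier_d1; exact: DT.
- have d2 z : D z -> is_derive z (delta_mx 0 j) (partial i barrier)
      (barrier_d2 (delta_mx 0 i) (delta_mx 0 j) z).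
    move=> Dz; apply: near_eq_is_derive (near_partial z i Dz) _.
    by apply: is_derive_barrier_d1; exact: DT.
  split; first by have [] := d2 x Dx.
  apply: (@near_continuous _ (barrier_d2 (delta_mx 0 i) (delta_mx 0 j))).
    by apply: open_near Do Dx _ => z /d2[_ <-].
  by apply: continuous_barrier_d2; exact: DT.
Qed.

Lemma barrier_d1_linear x (c : R) v w :
  barrier_d1 (c *: v + w) x = c * barrier_d1 v x + barrier_d1 w x.
Proof.
have rdirP l : rdir l (c *: v + w) = c * rdir l v + rdir l w.
  by rewrite /rdir mulmxDl -scalemxAl !mxE.
rewrite /barrier_d1 rdirP mulrBr mulr_sumr addrACA -big_split /=.
by congr (_ + _); [apply: eq_bigr => i _; rewrite rdirP; ring|ring].
Qed.

Lemma gradient_barrier x v : 0 < T x ->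
  dot v (gradient barrier x) = barrier_d1 v x.
Proof.
move=> T0; rewrite {2}[v]row_sum_delta /dot.
elim: (index_enum _) => [|j r IHr].
  (* Linearity with zero vectors reads d 0 = d 0 + d 0, which gives the value 0 for the empty
     sum. *)
  have := barrier_d1_linear x 1 0 0.
  by rewrite !big_nil scaler0 addr0 mul1r => d0; lra.
rewrite !big_cons barrier_d1_linear IHr mxE; congr (_ * _ + _).
by have [_] := is_derive_barrier (delta_mx 0 j) T0.
Qed.

Lemma hessian_barrier (D : set 'rV[R]_m.+1) x :
  open D -> (forall x, D x -> 0 < T x) -> D x ->
  hessian barrier x =
    \matrix_(i, j) barrier_d2 (delta_mx 0 i) (delta_mx 0 j) x.
Proof.
move=> Do DT Dx; apply/matrixP => i j; rewrite !mxE.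
have near_partial : \near x, barrier_d1 (delta_mx 0 i) x = partial i barrier x.
  apply: open_near Do Dx _ => z /DT T0.
  by have [_ <-] := is_derive_barrier (delta_mx 0 i) T0.
have d1 := is_derive_barrier_d1 (delta_mx 0 i) (delta_mx 0 j) (DT _ Dx).
by have [_ <-] := near_eq_is_derive near_partial d1.
Qed.

End Barrier.

(** * Hessian of the barrier: diagonalization, determinant and sign *)

Section BarrierHessian.
Context {R : realType} {m : nat}.
Variables (Q : 'M[R]_m.+1) (x0 : 'rV[R]_m.+1) (N theta : R) (beta : 'I_m -> R).
Implicit Types (x v w : 'rV[R]_m.+1) (i : 'I_m) (l : 'I_m.+1).

Local Notation tangential i := (widen_ord (leqnSn m) i).
Local Notation T := (rcoord Q x0 ord_max).
Local Notation Y i := (rcoord Q x0 (tangential i)).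
Local Notation tau := (rdir Q ord_max).
Local Notation ups i := (rdir Q (tangential i)).
Local Notation phi := (barrier Q x0 N theta beta).
Local Notation d1 := (barrier_d1 Q x0 N theta beta).
Local Notation d2 := (barrier_d2 Q x0 N theta beta).

(* Schur complement of the tangential block in the Hessian of [barrier]. *)
Definition normal_curvature x : R :=
  (N * theta * (1 - theta) * T x `^ theta
   - \sum_(i < m) beta i * (1 + beta i) * Y i x ^+ 2 * T x `^ beta i) / T x ^+ 2.

Let powRS (t p : R) : 0 < t -> t `^ (p - 1) = t `^ p / t.
Proof.
move=> t0; rewrite powRB; last by rewrite (gt_eqF t0) implybT.
by rewrite powRr1 // ltW.
Qed.

(** Complete the square in each tangential direction: the shift by beta_i Y_i / T absorbs the cross
    terms, and the remainder - beta_i (1 + beta_i) Y_i^2 T^(beta_i - 2) enters [normal_curvature].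
    Both convexity and the determinant are read off this form. *)
Lemma barrier_d2E v w x : 0 < T x ->
  d2 v w x = \sum_(i < m) 2 * T x `^ beta i
      * (ups i v + beta i * Y i x / T x * tau v)
      * (ups i w + beta i * Y i x / T x * tau w)
    + normal_curvature x * tau v * tau w.
Proof.
move=> T0; have Tn0 : T x != 0 by rewrite gt_eqF.
rewrite /barrier_d2 /normal_curvature !powRS //.
set G := fun i => beta i * (1 + beta i) * Y i x ^+ 2 * T x `^ beta i.
have -> : (N * theta * (1 - theta) * T x `^ theta - \sum_(i < m) G i) / T x ^+ 2
      * tau v * tau w =
    N * theta * (1 - theta) * T x `^ theta / T x ^+ 2 * tau v * tau w
    - \sum_(i < m) G i / T x ^+ 2 * tau v * tau w.
  by rewrite -!mulr_suml; ring.
rewrite addrCA -sumrB addrC; congr (_ + _); last by field.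
by apply: eq_bigr => i _; rewrite /G !powRS //; field.
Qed.

Let tangential_lift i : tangential i = lift ord_max i.
Proof. by apply: val_inj; rewrite /= /bump leqNgt ltn_ord. Qed.

Definition extend_last (f : 'I_m -> R) (c : R) l : R :=
  if unlift ord_max l is Some i then f i else c.

Lemma extend_last_tangential f c i : extend_last f c (tangential i) = f i.
Proof. by rewrite /extend_last tangential_lift liftK. Qed.

Lemma extend_last_max f c : extend_last f c ord_max = c.
Proof. by rewrite /extend_last unlift_none. Qed.

(** The matrix factors as (Q P) diag(d, c) (Q P)^T with P unit lower triangular, so only the
    diagonal factor contributes to the determinant. *)
Lemma det_arrow_congruence (g d : 'I_m -> R) (c : R) : \det Q = 1 ->
  \det (\matrix_(i, j) (\sum_(l < m) d l
      * (Q i (tangential l) + g l * Q i ord_max)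
      * (Q j (tangential l) + g l * Q j ord_max)
    + c * Q i ord_max * Q j ord_max)) = (\prod_(l < m) d l) * c.
Proof.
move=> detQ.
(* P is the identity with [g] added in its last row, so Q P adds g_l times the last column of Q to
   column l. The extension value 0 leaves the last column unchanged. *)
pose P : 'M[R]_m.+1 :=
  \matrix_(j, l) ((j == l)%:R + (j == ord_max)%:R * extend_last g 0 l).
pose D : 'rV[R]_m.+1 := \row_l extend_last d c l.
have detP : \det P = 1.
  rewrite det_trig; last first.
    apply/is_trig_mxP => j l jl; rewrite !mxE -!val_eqE /= (ltn_eqF jl).
    by rewrite (ltn_eqF (leq_trans jl (leq_ord l))) mul0r addr0.
  rewrite big1 // => l _; rewrite mxE eqxx.
  have [->|_] := eqVneq l ord_max; last by rewrite mul0r addr0.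
  by rewrite extend_last_max mulr0 addr0.
have QPE (i l : 'I_m.+1) : (Q *m P) i l = Q i l + extend_last g 0 l * Q i ord_max.
  rewrite mxE; under eq_bigr do rewrite mxE mulrDr.
  rewrite big_split /= (bigD1 l) //= eqxx mulr1 big1 ?addr0; last first.
    by move=> j /negPf ->; rewrite mulr0.
  congr (_ + _); rewrite (bigD1 ord_max) //= eqxx mul1r mulrC big1 ?addr0 //.
  by move=> j /negPf ->; rewrite mul0r mulr0.
have -> : (\prod_(l < m) d l) * c = \det (diag_mx D).
  rewrite det_diag big_ord_recr /= mxE extend_last_max; congr (_ * _).
  by apply: eq_bigr => l _; rewrite mxE extend_last_tangential.
have detQP : \det (Q *m P) = 1 by rewrite det_mulmx detQ detP mulr1.
transitivity (\det (Q *m P *m diag_mx D *m (Q *m P)^T)); last first.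
  by rewrite det_mulmx det_tr det_mulmx detQP mul1r mulr1.
congr (\det _); apply/matrixP => i j; rewrite [LHS]mxE [RHS]mxE big_ord_recr /=.
have QDE l : (Q *m P *m diag_mx D) i l * (Q *m P)^T l j =
    extend_last d c l * (Q i l + extend_last g 0 l * Q i ord_max)
      * (Q j l + extend_last g 0 l * Q j ord_max).
  by rewrite mul_mx_diag [X in X * _]mxE [X in _ * X]mxE !QPE [D _ _]mxE; ring.
rewrite QDE !extend_last_max !mul0r !addr0; congr (_ + _).
by apply: eq_bigr => l _; rewrite QDE !extend_last_tangential.
Qed.

Lemma det_hessian_barrier (D : set 'rV[R]_m.+1) x : \det Q = 1 ->
  open D -> (forall x, D x -> 0 < T x) -> D x ->
  \det (hessian phi x) =
    (\prod_(i < m) (2 * T x `^ beta i)) * normal_curvature x.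
Proof.
move=> detQ Do DT Dx; have T0 := DT x Dx.
rewrite -(@det_arrow_congruence (fun i => beta i * Y i x / T x)) //.
congr (\det _); rewrite (hessian_barrier _ _ _ Do DT Dx).
apply/matrixP => i j; rewrite !mxE barrier_d2E //.
by rewrite /rdir -!rowE; under eq_bigr do rewrite !mxE; rewrite !mxE.
Qed.

Lemma barrier_d2_ge0 x v : 0 < T x -> 0 <= normal_curvature x -> 0 <= d2 v v x.
Proof.
move=> T0 k0; rewrite barrier_d2E //; apply: addr_ge0.
  apply: sumr_ge0 => i _; rewrite -mulrA mulr_ge0 // ?sqr_ge0 //.
  by rewrite mulr_ge0 // powR_ge0.
by rewrite -mulrA mulr_ge0 // sqr_ge0.
Qed.

(** * Pointwise bounds for the barrier where Y_i^2 T^beta_i <= B T^theta *)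

Section Bounds.
Variables (B K r : R) (x : 'rV[R]_m.+1).
Hypotheses (theta01 : 0 < theta < 1) (beta1 : forall i, -1 <= beta i <= 1).
Hypotheses (T0 : 0 < T x).
Hypothesis YB : forall i, Y i x ^+ 2 * T x `^ beta i <= B * T x `^ theta.

Let P := T x `^ theta.
Let q i := Y i x ^+ 2 * T x `^ beta i.

Let P0 : 0 < P. Proof. exact: powR_gt0. Qed.

Let q_ge0 i : 0 <= q i.
Proof. by rewrite mulr_ge0 ?sqr_ge0 ?powR_ge0. Qed.

Let sum_le (c : R) (f : 'I_m -> R) :
  (forall i, f i <= c * P) -> \sum_(i < m) f i <= m%:R * c * P.
Proof.
move=> fc; apply: le_trans (ler_sum _ (fun i _ => fc i)) _.
by rewrite sumr_const card_ord -mulrA mulr_natl.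
Qed.

Lemma barrier_le : m%:R * B + 1 <= N -> phi x <= - T x `^ theta.
Proof.
move=> NB; rewrite /barrier -/P.
have := sum_le YB; rewrite -/P.
have : (m%:R * B + 1) * P <= N * P by rewrite ler_pM2r.
lra.
Qed.

Lemma barrier_ge : - (N * T x `^ theta) <= phi x.
Proof. by rewrite /barrier lerDr; apply: sumr_ge0 => i _; exact: q_ge0. Qed.

(** Since beta_i (1 + beta_i) <= 2, the subtracted sum is at most 2 m B T^theta. The factor 2 kept
    in the lower bound later makes the determinant inequality strict. *)
Lemma normal_curvature_ge : 2 + 2 * m%:R * B <= N * theta * (1 - theta) ->
  2 * T x `^ theta / T x ^+ 2 <= normal_curvature x.
Proof.
move=> NB; rewrite /normal_curvature -/P ler_pM2r ?invr_gt0 ?exprn_gt0 //.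
have : \sum_(i < m) beta i * (1 + beta i) * Y i x ^+ 2 * T x `^ beta i
    <= m%:R * (2 * B) * P.
  apply: sum_le => i; apply: (@le_trans _ _ (2 * q i)).
    rewrite -[leLHS]mulrA -/(q i) ler_wpM2r //.
    by have := beta1 i; nra.
  by rewrite -mulrA ler_pM2l // YB.
have : (2 + 2 * m%:R * B) * P <= N * theta * (1 - theta) * P by rewrite ler_pM2r.
lra.
Qed.

(** Write x as the difference of x and the origin in adapted coordinates, with p the height of the
    origin. Then x . D phi - phi is a nonnegative part S1 + S2 + N (1 - theta) P plus (p (N theta P
    - S2) - S3) / T. As p >= r, the assumption on N makes the last numerator at least P. *)
Lemma barrier_support_ge : 0 <= N -> r <= rcoord Q x0 ord_max 0 -> 0 <= r ->
  m%:R * B <= N * theta ->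
  (forall i, 2 * Y i x * Y i 0 * T x `^ beta i * T x <= K * T x `^ theta) ->
  1 <= r * (N * theta - m%:R * B) - m%:R * K ->
  T x `^ theta / T x <= dot x (gradient phi x) - phi x.
Proof.
move=> N0 rp r0 NB YK rN; rewrite gradient_barrier //.
have Tn0 : T x != 0 by rewrite gt_eqF.
have rdirE l : rdir Q l x = rcoord Q x0 l x - rcoord Q x0 l 0.
  by rewrite /rdir /rcoord mulmxBl mulmxBl mul0mx !mxE; ring.
set p := rcoord Q x0 ord_max 0.
pose S1 := \sum_(i < m) q i; pose S2 := \sum_(i < m) beta i * q i.
pose S3 := \sum_(i < m) 2 * Y i x * Y i 0 * T x `^ beta i * T x.
have d1E : d1 x x = 2 * S1 - S3 / T x + S2 - p / T x * S2
    - N * theta * (T x - p) * P / T x.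
  rewrite /barrier_d1 powRS // -/P rdirE -/p; congr (_ - _); last by ring.
  transitivity (\sum_(i < m) (2 * q i - 2 * Y i x * Y i 0 * T x `^ beta i * T x / T x
      + beta i * q i - p / T x * (beta i * q i))).
    by apply: eq_bigr => i _; rewrite powRS // !rdirE -/p /q; field.
  by rewrite sumrB big_split /= sumrB -!mulr_sumr -mulr_suml.
have phiE : phi x = S1 - N * P by [].
(* Termwise this is (1 + beta_i) q_i, with beta_i >= -1. *)
have S12 : 0 <= S1 + S2.
  rewrite -big_split /= sumr_ge0 // => i _; have := beta1 i; have := q_ge0 i.
  by nra.
have S2B : S2 <= m%:R * B * P.
  apply: sum_le => i; apply: le_trans (YB i); rewrite -[leRHS]mul1r -/(q i).
  by rewrite ler_wpM2r //; case/andP: (beta1 i).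
have S3K : S3 <= m%:R * K * P by exact: sum_le.
have -> : d1 x x - phi x = S1 + S2 + N * (1 - theta) * P
    + (p * (N * theta * P - S2) - S3) / T x.
  by rewrite d1E phiE; field.
apply: ler_wpDl.
  have [_ theta1] := andP theta01.
  by rewrite addr_ge0 // !mulr_ge0 ?(ltW P0) // subr_ge0 ltW.
rewrite -/P ler_pM2r ?invr_gt0 //.
have h1 : (N * theta - m%:R * B) * P <= N * theta * P - S2 by lra.
have h2 : 0 <= (N * theta - m%:R * B) * P by rewrite mulr_ge0 ?(ltW P0) // subr_ge0.
have h3 : r * ((N * theta - m%:R * B) * P) <= p * (N * theta * P - S2).
  by apply: ler_pM.
have h4 : 1 * P <= (r * (N * theta - m%:R * B) - m%:R * K) * P by rewrite ler_pM2r.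
lra.
Qed.

End Bounds.

End BarrierHessian.

(** * Comparison and decay at the boundary *)

Section Comparison.
Context {R : realType} {n : nat}.
Implicit Types (D : set 'rV[R]_n) (u phi : 'rV[R]_n -> R).

Lemma open_not_boundary D x : open D -> closure D x -> ~ boundary D x -> D x.
Proof.
move=> Do Dx nb; apply: contrapT => nDx; apply: nb; split => //.
by rewrite ((interior_id D).1 Do).
Qed.

(** If u < phi somewhere, u - phi attains a negative minimum over D; there a translate of phi
    touches u from below, and the supersolution inequality contradicts [strict]. *)
Lemma supersolution_comparison (k : R) D u phi :
  open D -> bounded_set D -> convex_viscosity_supersolution_bvp k D u ->
  C2_on D phi -> convex_function D phi -> (forall x, D x -> phi x <= 0) ->
  (forall z, D z -> u z < phi z ->
    `|u z| `^ (- n%:R - k - 2) * (dot z (gradient phi z) - u z) `^ (- k)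
      < \det (hessian phi z)) ->
  forall x, D x -> phi x <= u x.
Proof.
move=> Do Db [[uc _ _ super] u0] phi2 phic phi0 strict x Dx.
rewrite leNgt; apply/negP => ltu; pose c := u x - phi x.
have c0 : c < 0 by rewrite subr_lt0.
(* Minimizing over this sublevel set keeps away from the boundary, where u = 0 > c and phi is not
   controlled. Off K one has u > c and phi <= 0, so u - phi > c there and the minimum over K is
   global in D. *)
pose K := closure D `&` u @^-1` [set y | y <= c].
have KD : K `<=` D.
  move=> z [cz uz]; apply: open_not_boundary => // /u0 uz0.
  by move: uz; rewrite /= uz0 leNgt c0.
have Kc : closed K.
  have /closed_subspaceP[V Vc VE] :
      closed (u @^-1` [set y | y <= c] : set (subspace (closure D))).
    by apply: (continuous_closedP _).1 uc _ _; exact: closed_le.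
  by rewrite /K setIC -VE; apply: closedI => //; exact: closed_closure.
have Kb : bounded_set K.
  by apply: sub_boundedr Db => A DA z /KD /DA.
have ucD z : D z -> {for z, continuous u}.
  have : {within D, continuous u}.
    by apply: continuous_subspaceW uc; exact: subset_closure.
  by rewrite continuous_open_subspace // => ucD Dz; apply: ucD; rewrite inE.
have Kcont : {within K, continuous (fun z => u z - phi z)}.
  apply: continuous_in_subspaceT => z; rewrite inE => /KD Dz.
  exact: (cvgB (ucD z Dz) (phi2.1 z Dz).1).
have Kx : K x.
  by split; [exact: subset_closure|rewrite /= /c lerDl oppr_ge0 phi0].
have [z] := EVT_min_rV (ex_intro K x Kx) (bounded_closed_compact Kb Kc) Kcont.
rewrite inE => Kz zmin; have Dz := KD z Kz.
have zglob y : D y -> u z - phi z <= u y - phi y.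
  move=> Dy; have [uy|uy] := leP (u y) c.
    by apply: zmin; rewrite inE; split => //; exact: subset_closure.
  apply: (@le_trans _ _ c); first by apply: zmin; rewrite inE.
  by have := phi0 _ Dy; lra.
have := super phi z phi2 phic Dz (open_near Do Dz zglob).
have uz : u z < phi z by have := zglob x Dx; rewrite -/c; lra.
by rewrite leNgt strict.
Qed.

End Comparison.

(** * Euclidean norm, rotations and diameter *)

Section EuclideanLemmas.
Context {R : realType} {n : nat}.
Implicit Types (x y : 'rV[R]_n) (Q : 'M[R]_n).

Lemma coord_le_enorm x i : `|x 0 i| <= enorm x.
Proof.
rewrite -sqrtr_sqr ler_wsqrtr // /dot (bigD1 i) //= expr2 lerDl.
by apply: sumr_ge0 => j _; rewrite -expr2 sqr_ge0.
Qed.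

Lemma enormZ (c : R) x : enorm (c *: x) = `|c| * enorm x.
Proof.
rewrite /enorm -sqrtr_sqr -sqrtrM ?sqr_ge0 //; congr Num.sqrt.
by rewrite /dot mulr_sumr; apply: eq_bigr => i _; rewrite !mxE; ring.
Qed.

Lemma enormN x : enorm (- x) = enorm x.
Proof. by rewrite -scaleN1r enormZ normrN1 mul1r. Qed.

Lemma enorm_gt0 x : x != 0 -> 0 < enorm x.
Proof.
move=> x0; have [i xi] : exists i, x 0 i != 0.
  apply/existsP; apply: contraNT x0; rewrite negb_exists => /forallP x0.
  by apply/eqP/rowP => i; rewrite mxE; exact/eqP/negbNE/x0.
by apply: lt_le_trans (coord_le_enorm x i); rewrite normr_gt0.
Qed.

Lemma enorm_rotation Q x : is_rotation Q -> enorm (x *m Q) = enorm x.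
Proof.
have dotE (y : 'rV[R]_n) : dot y y = (y *m y^T) 0 0.
  by rewrite mxE; apply: eq_bigr => i _; rewrite mxE.
by case=> QQ _; rewrite /enorm !dotE trmx_mul mulmxA -(mulmxA x) QQ mulmx1.
Qed.

Lemma rotation_entry_le1 Q i j : is_rotation Q -> `|Q i j| <= 1.
Proof.
case=> QQ _; rewrite -(@ler_pXn2r _ 2) ?nnegrE // expr1n real_normK ?num_real //.
have /matrixP/(_ i i) := QQ; rewrite !mxE eqxx => QQi.
rewrite -[leRHS]/(true%:R) -QQi (bigD1 j) //= mxE -expr2 lerDl.
by apply: sumr_ge0 => l _; rewrite mxE -expr2 sqr_ge0.
Qed.

(** Boundedness in the sup norm bounds every coordinate, also on the closure, and so the Euclidean
    diameter. Taking M >= 1 makes powers of M increase with the exponent. *)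
Lemma bounded_enorm (D : set 'rV[R]_n) : bounded_set D ->
  exists2 M : R, 1 <= M & forall x y, closure D x -> closure D y -> enorm (x - y) <= M.
Proof.
move=> /ex_strict_bound_gt0[b b0 Db].
have cb x i : closure D x -> `|x 0 i| <= b.
  move=> cx; rewrite leNgt; apply/negP => xb.
  have /cx[z [Dz]] : nbhs x (fun z : 'rV[R]_n => b < `|z 0 i|).
    have cn : (fun z : 'rV[R]_n => `|z 0 i|) z @[z --> x] --> `|x 0 i|.
      exact: (cvg_norm (@coord_continuous _ _ _ 0 i x)).
    exact: cvgr_gt cn _ xb.
  apply/negP; rewrite -leNgt; apply: le_trans (ltW (Db z Dz)).
  by rewrite [leRHS]/Num.norm /= mx_normrE; apply/bigmax_geP; right; exists (0, i).
exists (1 + Num.sqrt (n%:R * (2 * b) ^+ 2)) => [|x y cx cy].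
  by rewrite lerDl sqrtr_ge0.
apply: ler_wpDl => //; rewrite ler_wsqrtr //.
apply: (@le_trans _ _ (\sum_(i < n) (2 * b) ^+ 2)); last first.
  by rewrite sumr_const card_ord [n%:R * _]mulr_natl.
apply: ler_sum => i _; rewrite !mxE -expr2.
have := cb x i cx; have := cb y i cy; rewrite !ler_norml => /andP[? ?] /andP[? ?].
by nra.
Qed.

End EuclideanLemmas.

(** * Inequalities between real powers *)

Section PowerEstimates.
Context {R : realType}.

Lemma powRN_antitone (x y p : R) : 0 < x -> x <= y -> 0 <= p ->
  y `^ (- p) <= x `^ (- p).
Proof.
move=> x0 xy p0; have y0 := lt_le_trans x0 xy.
rewrite !powRN lef_pV2 ?posrE ?powR_gt0 //.
by apply: ge0_ler_powR => //; rewrite nnegrE ltW.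
Qed.

Lemma prod_powR n (t : R) (b : 'I_n -> R) : 0 < t ->
  \prod_i t `^ b i = t `^ (\sum_i b i).
Proof.
move=> t0; elim/big_rec2: _ => [|i y1 y2 _ ->]; first by rewrite powRr0.
by rewrite powRD // (gt_eqF t0) implybT.
Qed.

(** Raise eta |y|^a <= t to the power 2/a and multiply by t^(theta - 2/a). *)
Lemma sqr_powR_le (eta a theta t y : R) : 0 < eta -> 0 < a -> 0 < t ->
  eta * `|y| `^ a <= t ->
  y ^+ 2 * t `^ (theta - 2 / a) <= eta `^ (- (2 / a)) * t `^ theta.
Proof.
move=> eta0 a0 t0 ya.
have a20 : 0 <= 2 / a by rewrite divr_ge0 // ltW.
have -> : y ^+ 2 = (`|y| `^ a) `^ (2 / a).
  rewrite -powRrM mulrCA divff ?gt_eqF // mulr1 powR_mulrn ?normr_ge0 //.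
  by rewrite real_normK // num_real.
have -> : t `^ theta = t `^ (2 / a) * t `^ (theta - 2 / a).
  by rewrite -powRD ?subrKC // (gt_eqF t0) implybT.
rewrite mulrA ler_pM2r ?powR_gt0 // powRN ler_pdivlMl ?powR_gt0 //.
rewrite -powRM ?powR_ge0 ?(ltW eta0) //.
by apply: ge0_ler_powR => //; rewrite nnegrE ?(ltW t0) // mulr_ge0 ?powR_ge0 ?ltW.
Qed.

(** With s = t^(theta - 2/a), the square s (y - p t)^2 >= 0 bounds the left side by s y^2 + p^2 s
    t^2. The first term is at most B t^theta; in the second, s t^2 = t^(2 - 2/a) t^theta <= M^2
    t^theta because 0 <= 2 - 2/a <= 2. *)
Lemma mixed_powR_le (a theta t y p B M : R) : 1 <= a -> 0 < t -> t <= M -> 1 <= M ->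
  `|p| <= M -> y ^+ 2 * t `^ (theta - 2 / a) <= B * t `^ theta ->
  2 * y * p * t `^ (theta - 2 / a) * t <= (B + M ^+ 4) * t `^ theta.
Proof.
move=> a1 t0 tM M1 pM yB; set s := t `^ (theta - 2 / a) in yB *.
have s0 : 0 < s by rewrite powR_gt0.
have M0 : 0 < M by lra.
have a2 : 0 <= 2 - 2 / a.
  rewrite subr_ge0 ler_pdivrMr; last by lra.
  by lra.
have a2' : 2 - 2 / a <= 2 by rewrite gerBl divr_ge0 //; lra.
have st : s * t ^+ 2 <= M ^+ 2 * t `^ theta.
  have -> : s * t ^+ 2 = t `^ (2 - 2 / a) * t `^ theta.
    rewrite -powR_mulrn ?(ltW t0) // /s -!powRD ?(gt_eqF t0) ?implybT //.
    by congr (_ `^ _); ring.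
  rewrite ler_pM2r ?powR_gt0 //.
  apply: (@le_trans _ _ (M `^ (2 - 2 / a))).
    by apply: ge0_ler_powR => //; rewrite nnegrE ltW.
  by rewrite -powR_mulrn ?(ltW M0) //; exact: ler_powR.
have p2 : p ^+ 2 <= M ^+ 2.
  by rewrite -real_normK ?num_real // ler_pXn2r // nnegrE ltW.
have h1 : p ^+ 2 * (s * t ^+ 2) <= M ^+ 2 * (M ^+ 2 * t `^ theta).
  by apply: ler_pM => //; rewrite ?sqr_ge0 // mulr_ge0 ?sqr_ge0 // ltW.
have h2 : 0 <= s * (y - p * t) ^+ 2 by rewrite mulr_ge0 ?sqr_ge0 // ltW.
nra.
Qed.

End PowerEstimates.

(** * Uniform choice of constants and decay at boundary points *)

Section BoundaryDecay.
Context {R : realType} {m : nat}.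
Variables (k : R) (a : 'I_m -> R) (Omega : set 'rV[R]_m.+1).
Hypotheses (k0 : 0 < k) (a2 : forall i, 2 <= a i).
Hypotheses (OmegaE : exterior_convex_domain a Omega) (Omega0 : Omega 0).

Let n := m.+1.
Let abar := \sum_(i < m) 2 / a i.
Let theta := (abar + 2 + k) / (2 * n%:R + 2 * k + 2).
Let beta i := theta - 2 / a i.

Let a_inv i : 0 <= 2 / a i <= 1.
Proof.
have := a2 i; move=> ai; rewrite divr_ge0 ?ler_pdivrMr //; lra.
Qed.

Let abar_itv : 0 <= abar <= m%:R.
Proof.
rewrite sumr_ge0 => [|i _]; last by case/andP: (a_inv i).
rewrite -[X in _ <= X%:R]card_ord -sumr_const /=.
by apply: ler_sum => i _; case/andP: (a_inv i).
Qed.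

Let den0 : 0 < 2 * n%:R + 2 * k + 2.
Proof. by have := ler0n R n; have := k0; lra. Qed.

(** As a_i >= 2, abar <= n - 1, so the numerator is at most n + 1 + k, half of the denominator. *)
Lemma theta_itv : 0 < theta <= 2^-1.
Proof.
have /andP[h0 h1] := abar_itv; have nE : n%:R = m%:R + 1 :> R by rewrite natr1.
rewrite divr_gt0 //=; last by have := k0; lra.
by rewrite ler_pdivrMr // nE; have := k0; lra.
Qed.

Let beta1 i : -1 <= beta i <= 1.
Proof.
have /andP[? ?] := a_inv i; have /andP[? ?] := theta_itv.
by rewrite /beta; apply/andP; split; lra.
Qed.

(** This identity is what fixes theta: the left side is the power of T in the Hessian determinant,
    the right side its power in the equation's right-hand side when |u| and x . Du - u scale like
    T^theta and T^(theta - 1). *)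
Let exponent_eq : \sum_(i < m) beta i + theta - 2 =
  theta * (- n%:R - k - 2) + (theta - 1) * - k.
Proof.
have thE : theta * (2 * n%:R + 2 * k + 2) = abar + 2 + k.
  by rewrite /theta divfK // gt_eqF.
rewrite sumrB sumr_const card_ord -/abar -mulr_natl.
have nE : n%:R = m%:R + 1 :> R by rewrite natr1.
by move: thE; rewrite nE; lra.
Qed.

(** A ball around the origin lies in Omega, hence above every admissible supporting hyperplane. The
    bound is independent of x0 and Q, as the uniform choice of N requires. *)
Lemma origin_depth : exists2 r : R, 0 < r &
  forall (Q : 'M[R]_n) x0, is_rotation Q ->
    (forall x, Omega x -> 0 < rcoord Q x0 ord_max x) ->
    r <= rcoord Q x0 ord_max 0.
Proof.
have [_ Oo _] : convex_domain Omega by case: OmegaE.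
have /nbhs_ballP[e /= e0 be] : nbhs (0 : 'rV[R]_m.+1) Omega by exact: open_nbhs_nbhs.
exists (e / 2); first by rewrite divr_gt0.
(* The test point moves from the origin by e/2 against the inner normal, the last column of Q;
   entries of Q are at most 1 in size, so it stays in the sup-norm ball. *)
move=> Q x0 rQ pos; pose x : 'rV[R]_n := \row_j (- (e / 2) * Q j ord_max).
have Ox : Omega x.
  apply: be; rewrite -ball_normE /= sub0r normrN.
  rewrite [ltLHS]/Num.norm /= mx_normrE; apply/bigmax_ltP; split => //= -[i j] _ /=.
  rewrite mxE normrM normrN (gtr0_norm (divr_gt0 e0 _)) //.
  have := rotation_entry_le1 j ord_max rQ; have := normr_ge0 (Q j ord_max).
  by nra.
have := pos x Ox; rewrite /rcoord mulmxBl [X in 0 < X]mxE.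
have -> : (x *m Q) 0 ord_max = - (e / 2).
  have [/mulmx1C /matrixP/(_ ord_max ord_max)] := rQ.
  rewrite !mxE eqxx => QQ _.
  rewrite -[RHS]mulr1 -[X in _ = _ * X]/(true%:R) -QQ mulr_sumr.
  by apply: eq_bigr => j _; rewrite !mxE; ring.
by rewrite [in X in _ -> X]mulmxBl mul0mx !mxE; lra.
Qed.

Lemma supersolution_boundary_decay : exists2 N : R, 0 < N &
  forall u, convex_viscosity_supersolution_bvp k Omega u ->
  forall x0 x, boundary Omega x0 -> Omega x ->
    - u x <= N * enorm (x - x0) `^ theta.
Proof.
have [[_ Oo Oc] Ob _ [eta [eta0 ext]]] := OmegaE.
have [r r0 depth] := origin_depth.
have [M M1 diam] := bounded_enorm Ob.
have /andP[theta0 theta_le] := theta_itv.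
have theta01 : 0 < theta < 1 by rewrite theta0 /=; lra.
pose B := \sum_(i < m) eta i `^ (- (2 / a i)).
pose K := B + M ^+ 4.
have B0 : 0 <= B by apply: sumr_ge0 => i _; exact: powR_ge0.
have etaB i : eta i `^ (- (2 / a i)) <= B.
  rewrite /B (bigD1 i) //= lerDl; apply: sumr_ge0 => j _; exact: powR_ge0.
have K0 : 0 <= K by rewrite addr_ge0 // exprn_ge0 //; lra.
have mB0 : 0 <= m%:R * B by rewrite mulr_ge0.
have mK0 : 0 <= m%:R * K by rewrite mulr_ge0.
have theta1 : 0 < 1 - theta by lra.
(* [N1] gives equality in the requirement of the curvature bound and [N2] in that of the support
   bound. Their sum with 1 + m B meets all requirements at once. *)
pose N1 := (2 + 2 * m%:R * B) / (theta * (1 - theta)).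
pose N2 := (1 + m%:R * K) / r / theta + m%:R * B / theta.
have N1E : N1 * theta * (1 - theta) = 2 + 2 * m%:R * B.
  by rewrite -mulrA divfK // gt_eqF // mulr_gt0.
have N2E : N2 * theta = (1 + m%:R * K) / r + m%:R * B.
  by rewrite mulrDl !divfK // gt_eqF.
have N10 : 0 <= N1 by apply: divr_ge0; [lra|rewrite ltW // mulr_gt0].
have N20 : 0 <= N2.
  apply: addr_ge0; apply: divr_ge0 => //; try exact: ltW.
  by apply: divr_ge0; [rewrite addr_ge0|exact: ltW].
pose N := 1 + m%:R * B + N1 + N2.
have N0 : 0 < N by rewrite /N; lra.
have NB1 : m%:R * B + 1 <= N by rewrite /N; lra.
have NB2 : 2 + 2 * m%:R * B <= N * theta * (1 - theta).
  rewrite -N1E -(mulrA N1) -(mulrA N); apply: ler_wpM2r.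
    by rewrite ltW // mulr_gt0.
  by rewrite /N; lra.
have N2theta : N2 * theta <= N * theta by rewrite ler_pM2r // /N; lra.
have r1K : 0 <= (1 + m%:R * K) / r by apply: divr_ge0; [rewrite addr_ge0|exact: ltW].
have NB3 : m%:R * B <= N * theta by lra.
have NB4 : 1 <= r * (N * theta - m%:R * B) - m%:R * K.
  have : r * ((1 + m%:R * K) / r) <= r * (N * theta - m%:R * B).
    by rewrite ler_pM2l //; lra.
  by rewrite mulrCA divff ?mulr1 ?gt_eqF //; lra.
(* N is fixed before u, x0 and the rotation, from Omega and k alone. *)
exists N => // u super x0 x bx0 Ox; have [Q [rQ extQ]] := ext x0 bx0.
have detQ : \det Q = 1 by case: rQ.
pose T := rcoord Q x0 ord_max; pose Y i := rcoord Q x0 (widen_ord (leqnSn m) i).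
have extT z : Omega z -> \sum_(i < m) eta i * `|Y i z| `^ a i < T z by exact: extQ.
have T0 z : Omega z -> 0 < T z.
  move=> /extT; apply: le_lt_trans; apply: sumr_ge0 => i _.
  by rewrite mulr_ge0 ?powR_ge0 // ltW.
have rcoord_le z l : `|rcoord Q x0 l z| <= enorm (z - x0).
  by rewrite -(enorm_rotation _ rQ); exact: coord_le_enorm.
have cx0 : closure Omega x0 by case: bx0.
have rcoord_leM z l : Omega z -> `|rcoord Q x0 l z| <= M.
  move=> Oz; apply: le_trans (rcoord_le _ _) _.
  by apply: diam => //; exact: subset_closure.
have a0 i : 0 < a i by have := a2 i; lra.
have YB z i : Omega z -> Y i z ^+ 2 * T z `^ beta i <= B * T z `^ theta.
  move=> Oz; apply: (@le_trans _ _ (eta i `^ (- (2 / a i)) * T z `^ theta)).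
    apply: sqr_powR_le => //; first exact: T0.
    apply: le_trans (ltW (extT z Oz)); rewrite (bigD1 i) //= lerDl.
    by apply: sumr_ge0 => j _; rewrite mulr_ge0 ?powR_ge0 // ltW.
  by rewrite ler_pM2r ?powR_gt0 // T0.
have YK z i : Omega z ->
    2 * Y i z * Y i 0 * T z `^ beta i * T z <= K * T z `^ theta.
  move=> Oz; apply: mixed_powR_le; rewrite ?T0 ?YB ?rcoord_leM //.
    by have := a2 i; lra.
  by apply: le_trans (rcoord_leM z ord_max Oz); exact: ler_norm.
pose phi := barrier Q x0 N theta beta.
have phi_le z : Omega z -> phi z <= - T z `^ theta.
  by move=> Oz; apply: (barrier_le (T0 z Oz)) NB1 => i; exact: YB.
have curv z : Omega z -> 2 * T z `^ theta / T z ^+ 2 <=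
    normal_curvature Q x0 N theta beta z.
  by move=> Oz; apply: (normal_curvature_ge beta1 (T0 z Oz)) NB2 => i; exact: YB.
have curv0 z : Omega z -> 0 <= normal_curvature Q x0 N theta beta z.
  move=> Oz; apply: le_trans (curv z Oz).
  by rewrite divr_ge0 ?sqr_ge0 // mulr_ge0 ?powR_ge0.
have phi2 : C2_on Omega phi by exact: C2_on_barrier.
have phi_convex : convex_function Omega phi.
  apply: (convex_function_of_derive2 Oc) => z v Oz.
  - exact: is_derive_barrier (T0 z Oz).
  - exact: is_derive_barrier_d1 (T0 z Oz).
  - exact: barrier_d2_ge0 (T0 z Oz) (curv0 z Oz).
have strict z : Omega z -> u z < phi z ->
    `|u z| `^ (- n%:R - k - 2) * (dot z (gradient phi z) - u z) `^ (- k)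
      < \det (hessian phi z).
  move=> Oz uphi; have t0 := T0 z Oz; have tt0 : 0 < T z `^ theta by rewrite powR_gt0.
  have tn0 : (T z == 0) = false by rewrite gt_eqF.
  have support : T z `^ theta / T z <= dot z (gradient phi z) - phi z.
    exact: (barrier_support_ge theta01 beta1 t0 (YB z ^~ Oz) (ltW N0)
      (depth _ _ rQ T0) (ltW r0) NB3 (YK z ^~ Oz) NB4).
  pose e := \sum_(i < m) beta i + theta - 2.
  (* From u < phi <= - T^theta follow |u| >= T^theta and, with the support bound, z . D phi - u >=
     T^(theta - 1); both exponents are negative, so the product is bounded above. *)
  have rhs : `|u z| `^ (- n%:R - k - 2) * (dot z (gradient phi z) - u z) `^ (- k)
      <= T z `^ e.
    rewrite /e exponent_eq [leRHS]powRD ?tn0 ?implybT //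
      (powRrM _ theta) (powRrM _ (theta - 1)).
    apply: ler_pM; rewrite ?powR_ge0 //.
      have -> : - n%:R - k - 2 = - (n%:R + k + 2) by ring.
      apply: powRN_antitone => //; last by rewrite !addr_ge0 // ltW.
      by have uneg := phi_le z Oz; rewrite ltr0_norm; lra.
    apply: powRN_antitone; rewrite ?powR_gt0 // ?(ltW k0) //.
    rewrite powRB ?tn0 ?implybT // powRr1 ?(ltW t0) //.
    by apply: le_trans support _; lra.
  apply: le_lt_trans rhs _; rewrite (det_hessian_barrier _ _ _ detQ Oo T0 Oz).
  (* The tangential factors 2 T^beta_i are weakened to T^beta_i; the factor 2 of the curvature bound
     supplies strictness. *)
  apply: (@lt_le_trans _ _ (T z `^ (\sum_(i < m) beta i)
      * (2 * T z `^ theta / T z ^+ 2))).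
    rewrite /e -addrA powRD ?tn0 ?implybT // ltr_pM2l ?powR_gt0 //.
    rewrite powRB ?tn0 ?implybT // powR_mulrn ?(ltW t0) //.
    by rewrite ltr_pM2r ?invr_gt0 ?exprn_gt0 //; lra.
  rewrite -prod_powR //; apply: ler_pM (curv z Oz).
  - by apply: prodr_ge0 => i _; exact: powR_ge0.
  - by rewrite divr_ge0 ?sqr_ge0 // mulr_ge0 ?(ltW tt0).
  - apply: ler_prod => i _; rewrite powR_ge0 /=.
    by have := powR_ge0 (T z) (beta i); lra.
have phi0 z : Omega z -> phi z <= 0.
  by move=> Oz; apply: le_trans (phi_le z Oz) _; rewrite oppr_le0 powR_ge0.
have phiu := supersolution_comparison Oo Ob super phi2 phi_convex phi0 strict Ox.
have phix : - (N * T x `^ theta) <= phi x by exact: barrier_ge.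
apply: (@le_trans _ _ (N * T x `^ theta)); first by lra.
rewrite ler_pM2l //; apply: ge0_ler_powR; rewrite ?nnegrE ?(ltW theta0) //.
- exact: ltW (T0 x Ox).
- exact: sqrtr_ge0.
- by apply: le_trans (rcoord_le x ord_max); exact: ler_norm.
Qed.

End BoundaryDecay.

(** * From boundary decay to the Hoelder bound *)

Section HolderFromDecay.
Context {R : realType} {n : nat}.
Implicit Types (D : set 'rV[R]_n) (x y v : 'rV[R]_n) (s : R).

(** Take s to be the supremum of the parameters t >= 0 with x + t v in D. The last clause lets a
    bound proved for points of D pass to s itself. *)
Lemma ray_exit D x v : open D -> bounded_set D -> D x -> v != 0 ->
  exists s, [/\ boundary D (s *: v + x),
    (forall t, 0 <= t -> D (t *: v + x) -> t <= s) &
    (forall c, (forall t, 0 <= t -> D (t *: v + x) -> t <= c) -> s <= c)].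
Proof.
move=> Do Db Dx v0; have [M _ diam] := bounded_enorm Db.
pose S := [set t : R | 0 <= t /\ D (t *: v + x)].
have S0 : S !=set0 by exists 0; rewrite /S /= scale0r add0r.
have Sub : has_ubound S.
  exists (M / enorm v) => t [t0 Dt]; rewrite ler_pdivlMr ?enorm_gt0 //.
  have := diam _ _ (subset_closure Dt) (subset_closure Dx).
  by rewrite addrK enormZ ger0_norm.
have le_sup t : 0 <= t -> D (t *: v + x) -> t <= sup S.
  by move=> t0 Dt; apply: ub_le_sup.
have gc : {for sup S, continuous (fun t : R => t *: v + x)}.
  by apply: cvgD; [exact: scalel_continuous|exact: cvg_cst].
exists (sup S); split => //; last first.
  by move=> c Sc; apply: ge_sup => // t [t0 Dt]; exact: Sc.
split=> [B /gc gB|].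
  have [t [[_ Dt] Bt]] := closure_sup S0 Sub gB.
  by exists (t *: v + x).
(* If the exit point were in the open set D, a slightly larger parameter would still be
   admissible. *)
rewrite ((interior_id D).1 Do) => Dsup.
have /nbhs_ballP[e /= e0 be] : nbhs (sup S) (fun t : R => D (t *: v + x)).
  by apply: gc; exact: open_nbhs_nbhs.
have sup0 : 0 <= sup S by apply: le_sup; rewrite // scale0r add0r.
have : sup S + e / 2 <= sup S.
  apply: le_sup; first by rewrite addr_ge0 // divr_ge0 // ltW.
  apply: be; rewrite /ball /= opprD addrA subrr sub0r normrN gtr0_norm ?divr_gt0 //.
  by lra.
by lra.
Qed.

Lemma holder_of_boundary_decay D (u : 'rV[R]_n -> R) (N theta : R) :
  open D -> bounded_set D -> convex_function D u -> (forall x, D x -> u x < 0) ->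
  (forall x, boundary D x -> u x = 0) -> 0 <= N -> 0 <= theta <= 1 ->
  (forall x0 x, boundary D x0 -> D x -> - u x <= N * enorm (x - x0) `^ theta) ->
  forall x y, closure D x -> closure D y ->
    `|u x - u y| <= N * enorm (x - y) `^ theta.
Proof.
move=> Do Db uc ul u0 N0 /andP[theta0 theta1] decay.
have rhs0 x y : 0 <= N * enorm (x - y) `^ theta by rewrite mulr_ge0 ?powR_ge0.
have enormC x y : enorm (x - y) = enorm (y - x) by rewrite -enormN opprB.
have closureE x : closure D x -> D x \/ boundary D x.
  move=> cx; have [bx|/(open_not_boundary Do cx)] := pselect (boundary D x);
    by [right|left].
suff main x y : closure D x -> closure D y ->
    u y - u x <= N * enorm (x - y) `^ theta.
  move=> x y cx cy; rewrite ler_norml lerNl opprB main //= enormC.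
  exact: main.
move=> /closureE[Dx|bx] /closureE[Dy|by_]; last first.
- by rewrite !u0 // subrr.
- by rewrite (u0 x) // subr0; apply: le_trans (rhs0 x y); exact/ltW/ul.
- by rewrite (u0 y) // sub0r decay.
have [->|xy] := eqVneq x y; first by rewrite subrr.
have [uyx|uxy] := leP (u y) (u x); first by apply: le_trans (rhs0 x y); lra.
have v0 : y - x != 0 by rewrite subr_eq0 eq_sym.
have [s [bs maxs mins]] := ray_exit Do Db Dx v0.
have s1 : 1 <= s by apply: maxs => //; rewrite scale1r subrK.
have d0 : 0 < u y - u x by rewrite subr_gt0.
(* Here y is the convex combination of the point at parameter t, with weight 1/t, and x. Convexity
   and u < 0 at that point give t (u y - u x) <= - u x. *)
have slope t : 1 <= t -> D (t *: (y - x) + x) -> t <= - u x / (u y - u x).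
  move=> t1 Dt; have t0 : 0 < t by lra.
  have t01 : 0 <= t^-1 <= 1 by rewrite invr_ge0 ltW //= invf_le1.
  pose tt := Itv01 (andP t01).1 (andP t01).2.
  have := uc tt (t *: (y - x) + x) x (mem_set Dt) (mem_set Dx).
  have -> : conv tt (t *: (y - x) + x : convex_lmodType 'rV[R]_n)
      (x : convex_lmodType 'rV[R]_n) = y.
    rewrite /conv /= scalerDr scalerA mulVf ?gt_eqF // scale1r scalerBl scale1r.
    by rewrite -addrA [t^-1 *: x + _]addrC subrK subrK.
  rewrite convRE /= => uyt; have ut := ul _ Dt.
  rewrite ler_pdivlMr //.
  have h : t * u y <= t * (t^-1 * u (t *: (y - x) + x) + (1 - t^-1) * u x).
    by rewrite ler_pM2l.
  have ht : t * (t^-1 * u (t *: (y - x) + x) + (1 - t^-1) * u x) =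
     u (t *: (y - x) + x) + (t - 1) * u x by field; rewrite gt_eqF.
  by move: h; rewrite ht; lra.
have sle : s <= - u x / (u y - u x).
  have h1 : 1 <= - u x / (u y - u x) by apply: slope => //; rewrite scale1r subrK.
  apply: mins => t t0 Dt; have [t1|t1] := leP 1 t; first exact: slope.
  by lra.
have s0 : 0 < s by lra.
(* It remains to compare s (u y - u x) <= - u x <= N (s |x - y|)^theta with s N |x - y|^theta, where
   s^theta <= s because s >= 1 and theta <= 1. *)
rewrite -(ler_pM2l s0).
apply: (@le_trans _ _ (- u x)); first by move: sle; rewrite ler_pdivlMr.
apply: (le_trans (decay _ _ bs Dx)).
have -> : enorm (x - (s *: (y - x) + x)) = s * enorm (x - y).
  by rewrite opprD addrCA subrr addr0 enormN enormZ gtr0_norm // enormC.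
rewrite powRM ?(ltW s0) ?sqrtr_ge0 // mulrCA.
by apply: ler_wpM2r => //; exact: ler1_powR.
Qed.

End HolderFromDecay.

(** * Uniform bound of the Hoelder norm *)

Theorem corollary1p2 (R : realType) (m : nat) (n := m.+1) (hn : (2 <= n)%N)
  (k : R) (hk : 0 < k) (a : 'I_m -> R) (ha : forall i, 2 <= a i)
  (Omega : set 'rV[R]_n) (hOmega : exterior_convex_domain a Omega)
  (h0 : Omega 0)
  (abar := \sum_(i < m) 2 / a i)
  (theta := (abar + 2 + k) / (2 * n%:R + 2 * k + 2)) :
  exists C : R, 0 < C /\
    forall u : 'rV[R]_n -> R,
      convex_viscosity_supersolution_bvp k Omega u ->
      holder_space theta (closure Omega) u /\
      (holder_norm theta (closure Omega) u <= C%:E)%E.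
Proof.
have /andP[theta0 theta2] : 0 < theta <= 2^-1 := theta_itv hk ha.
have theta01 : 0 <= theta <= 1 by rewrite ltW //=; lra.
have [N N0 decay] := supersolution_boundary_decay hk ha hOmega h0.
have [[_ Oo _] Ob _ _] := hOmega.
have [M M1 diam] := bounded_enorm Ob.
have M0 : 0 < M by lra.
(* The first summand bounds the sup norm, the second the seminorm. *)
exists (N * M `^ theta + N); split.
  by rewrite addr_gt0 // mulr_gt0 // powR_gt0.
move=> u super; have [[uc uconv uneg _] u0] := super.
have holder := holder_of_boundary_decay Oo Ob uconv uneg u0 (ltW N0) theta01
  (decay u super).
(* A boundary point, found on a ray from the origin, turns the Hoelder estimate into a sup bound
   since u b = 0. *)
have [b bO] : exists b, boundary Omega b.
  have e0 : const_mx 1 != 0 :> 'rV[R]_n.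
    by apply/eqP => /rowP/(_ 0); rewrite !mxE => /eqP; rewrite oner_eq0.
  by have [s [bs _ _]] := ray_exit Oo Ob h0 e0; exists (s *: const_mx 1 + 0).
have sup_le : (sup_norm (closure Omega) u <= (N * M `^ theta)%:E)%E.
  apply: ge_ereal_sup => _ [x cx <-]; rewrite lee_fin -[u x]subr0 -(u0 b bO).
  have cb : closure Omega b by case: bO.
  apply: le_trans (holder x b cx cb) _; rewrite ler_pM2l //.
  by apply: ge0_ler_powR; rewrite ?nnegrE ?sqrtr_ge0 ?(ltW theta0) ?(ltW M0) // diam.
have semi_le : (holder_seminorm theta (closure Omega) u <= N%:E)%E.
  apply: ge_ereal_sup => _ [x [y [cx cy xy ->]]]; rewrite lee_fin.
  by rewrite ler_pdivrMr ?powR_gt0 ?enorm_gt0 ?subr_eq0 // holder.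
have norm_le : (holder_norm theta (closure Omega) u <= (N * M `^ theta + N)%:E)%E.
  by rewrite EFinD; exact: leeD.
by do 2?split => //; exact: le_lt_trans norm_le (ltry _).
Qed.
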